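(* Let $m\geq2$, $u=4t/(1+t)^{2}$, $z=(1+t)x/(1-t)$, and \[ e_{m,j,k}=4\sum_{l=1}^{k}{l+jm-1 \choose l-1}{jm-2 \choose k-l},\qquad e_{m,j,k}^{\prime}=4\sum_{l=1}^{k}{l+jm \choose l-1}{jm-1 \choose k-l}. \] Then (a) \[ \frac{1}{1-t}\sum_{n=0}^{\infty}P_{m\cdots21,n}^{\mathrm{ilpk}}(s,u)z^{n}=\sum_{n=0}^{\infty}\Bigg(\frac{z}{1-t}+\frac{4t(s-1)z^{m}}{(1-t^{2})(1+t)(1-(s-1)\sum_{l=1}^{m-1}z^{l})}\Bigg)^{*\langle n\rangle}, \] (b) \[ \frac{1}{1-t}\sum_{n=0}^{\infty}P_{m\cdots21,n}^{\mathrm{ilpk}}(u)z^{n}=\sum_{n=0}^{\infty}\left(\frac{(1+t)^{2}z-4tz^{m}-(1-t)^{2}z^{m+1}}{(1-t^{2})(1+t)(1-z^{m})}\right)^{*\langle n\rangle}, \] and (c) \[ \frac{1}{1-t}\sum_{n=0}^{\infty}P_{m\cdots21,n}^{\mathrm{ilpk}}(u)z^{n}=\frac{1}{1-x}+\sum_{k=1}^{\infty}\left[1-(2k+1)x+\sum_{j=1}^{\infty}(e_{m,j,k}x^{jm}-e_{m,j,k}^{\prime}x^{jm+1})\right]^{-1}t^{k}. \]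
   Context: $\mathfrak{S}_n$ is the set of permutations of $[n]$ in one-line notation ($\mathfrak{S}_0$ = empty permutation); $m\cdots21$ denotes the decreasing permutation in $\mathfrak{S}_m$. $\operatorname{std}$ of a sequence of distinct integers replaces its letters by $1,2,\dots$ in order of size. For $\pi\in\mathfrak{S}_n$ and $\sigma\in\mathfrak{S}_m$, $\operatorname{occ}_\sigma(\pi)$ is the number of $i\in[n-m+1]$ with $\operatorname{std}(\pi_i\cdots\pi_{i+m-1})=\sigma$. A left peak of $\pi$ is $i\in\{2,\dots,n-1\}$ with $\pi_{i-1}<\pi_i>\pi_{i+1}$, or $i=1$ if $n\ge2$ and $\pi_1>\pi_2$; $\operatorname{lpk}$ counts left peaks and $\operatorname{ilpk}(\pi)=\operatorname{lpk}(\pi^{-1})$. $P_{\sigma,n}^{\mathrm{ilpk}}(s,t)=\sum_{\pi\in\mathfrak{S}_n}s^{\operatorname{occ}_\sigma(\pi)}t^{\operatorname{ilpk}(\pi)}$ for $n\ge1$, $=1$ for $n=0$, and $P_{\sigma,n}^{\mathrm{ilpk}}(t)=P_{\sigma,n}^{\mathrm{ilpk}}(0,t)$. In (a),(b) the right sides are computed in formal power series with ordinary multiplication in $s,x$ and the Hadamard product in $t$: $(\sum_n a_nt^n)*(\sum_n b_nt^n)=\sum_n a_nb_nt^n$; $f^{*\langle n\rangle}$ is the $n$-fold Hadamard product, $f^{*\langle0\rangle}=1/(1-t)$. In (c), $[\cdot]^{-1}$ is the ordinary inverse in $\mathbb{Q}[[x]]$. Other expressions use ordinary multiplication. *)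

(* Defs.v *)
From HB Require Import structures.
From mathcomp Require Import all_boot all_order all_algebra all_fingroup.
From mathcomp Require Import boolp classical_sets cardinality fsbigop.

Set Implicit Arguments.
Unset Strict Implicit.
Unset Printing Implicit Defensive.

Import GRing.Theory.

Record fps (R : Type) := Fps { fps_coef :> nat -> R }.

Notation "{ 'fps' R }" := (fps R) (at level 0, R at level 100,
  format "{ 'fps'  R }") : type_scope.

HB.instance Definition _ (R : Type) := gen_eqMixin {fps R}.
HB.instance Definition _ (R : Type) := gen_choiceMixin {fps R}.

Lemma fpsP (R : Type) (f g : {fps R}) : (forall n, f n = g n) <-> f = g.
Proof.
split=> [fg|-> //]; case: f g fg => f [g] /= fg; congr Fps.
exact/funext.
Qed.

Local Open Scope ring_scope.

Section FpsZmodule.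
Variable R : zmodType.
Implicit Types f g h : {fps R}.

Definition fps_zero : {fps R} := Fps (fun=> 0).
Definition fps_opp f := Fps (fun n => - f n).
Definition fps_add f g := Fps (fun n => f n + g n).

Fact fps_addA : associative fps_add.
Proof. by move=> f g h; apply/fpsP => n; exact: addrA. Qed.
Fact fps_addC : commutative fps_add.
Proof. by move=> f g; apply/fpsP => n; exact: addrC. Qed.
Fact fps_add0 : left_id fps_zero fps_add.
Proof. by move=> f; apply/fpsP => n; exact: add0r. Qed.
Fact fps_addN : left_inverse fps_zero fps_opp fps_add.
Proof. by move=> f; apply/fpsP => n; exact: addNr. Qed.

HB.instance Definition _ :=
  GRing.isZmodule.Build {fps R} fps_addA fps_addC fps_add0 fps_addN.

End FpsZmodule.

Section FpsRing.
Variable R : comNzRingType.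
Implicit Types f g h : {fps R}.

Definition fpsC (c : R) : {fps R} := Fps (fun n => if n == 0%N then c else 0).
Definition fpsX : {fps R} := Fps (fun n => (n == 1%N)%:R).
Definition fps_mul f g :=
  Fps (fun n => \sum_(i < n.+1) f i * g (n - i)%N).

Fact fps_mulC : commutative fps_mul.
Proof.
move=> f g; apply/fpsP => n /=; rewrite (reindex_inj rev_ord_inj) /=.
by apply: eq_bigr => i _; rewrite subSS subKn ?leq_ord // mulrC.
Qed.

Fact fps_mulA : associative fps_mul.
Proof.
move=> p q r; apply/fpsP=> i; rewrite (fps_mulC q r) (fps_mulC _ r) /=.
pose coef3 j k := p j * (q (i - j - k)%N * r k).
transitivity (\sum_(j < i.+1) \sum_(k < i.+1 | (k <= i - j)%N) coef3 j k).
  apply: eq_bigr => /= j _; rewrite big_distrr /=.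
  rewrite (big_ord_narrow_leq (leq_subr _ _)).
  by apply: eq_bigr => k _; rewrite /coef3 (mulrC (r _)).
rewrite (exchange_big_dep predT) //=; apply: eq_bigr => k _.
transitivity (\sum_(j < i.+1 | (j <= i - k)%N) coef3 j k).
  apply: eq_bigl => j; rewrite -ltnS -(ltnS j) -!subSn ?leq_ord //.
  by rewrite -subn_gt0 -(subn_gt0 j) -!subnDA addnC.
rewrite (big_ord_narrow_leq (leq_subr _ _)) big_distrr /=.
apply: eq_bigr => j _.
by rewrite /coef3 -!subnDA addnC mulrA mulrC.
Qed.

Fact fps_mul1 : left_id (fpsC 1) fps_mul.
Proof.
move=> f; apply/fpsP => n /=; rewrite big_ord_recl /= mul1r subn0.
by rewrite big1 ?addr0 // => i _; rewrite mul0r.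
Qed.

Fact fps_mulDl : left_distributive fps_mul +%R.
Proof.
move=> f g h; apply/fpsP => n /=; rewrite -big_split /=.
by apply: eq_bigr => i _; rewrite mulrDl.
Qed.

Fact fps_oner_neq0 : fpsC 1 != 0.
Proof.
by apply/eqP => /fpsP/(_ 0%N)/= /eqP; rewrite oner_eq0.
Qed.

HB.instance Definition _ := GRing.Zmodule_isComNzRing.Build {fps R}
  fps_mulA fps_mulC fps_mul1 fps_mulDl fps_oner_neq0.

End FpsRing.

Arguments fpsX {R}.

Section FpsUnitRing.
Variable R : comUnitRingType.
Implicit Types f g : {fps R}.

(* The first n coefficients of the inverse, obtained by solving f * g = 1
   degree by degree; meaningful when f 0 is a unit. *)
Fixpoint fps_inv_seq f n : seq R :=
  if n is n'.+1 then
    let g := fps_inv_seq f n' in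
    rcons g ((f 0%N)^-1 * ((n' == 0%N)%:R - \sum_(i < n') g`_i * f (n' - i)%N))
  else [::].

Definition fps_unit : {pred {fps R}} := fun f => f 0%N \is a GRing.unit.
Definition fps_inv f : {fps R} :=
  if fps_unit f then Fps (fun n => (fps_inv_seq f n.+1)`_n) else f.

Fact size_fps_inv_seq f n : size (fps_inv_seq f n) = n.
Proof. by elim: n => //= n IHn; rewrite size_rcons IHn. Qed.

Fact nth_fps_inv_seq f n i :
  (i < n)%N -> (fps_inv_seq f n)`_i = (fps_inv_seq f i.+1)`_i.
Proof.
elim: n => // n IHn; rewrite ltnS leq_eqVlt => /predU1P[-> //|lt_in].
by rewrite [LHS]/= nth_rcons size_fps_inv_seq lt_in IHn.
Qed.

Fact fps_mulVf : {in fps_unit, left_inverse 1 fps_inv *%R}.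
Proof.
move=> f Uf; apply/fpsP => n; rewrite /fps_inv (Uf : fps_unit f = true).
rewrite [LHS]big_ord_recr /= subnn nth_rcons size_fps_inv_seq ltnn eqxx.
rewrite mulrC mulVKr //.
under eq_bigr => i _.
  rewrite -[nth 0 _ _]/((fps_inv_seq f i.+1)`_i) -(@nth_fps_inv_seq f n) //; over.
by rewrite addrC subrK; case: n.
Qed.

Fact fps_unitP f g : g * f = 1 -> fps_unit f.
Proof.
move=> /fpsP/(_ 0%N) /=; rewrite big_ord1 /= => gf1.
by apply/unitrPr; exists (g 0%N); rewrite mulrC.
Qed.

Fact fps_inv_out : {in [predC fps_unit], fps_inv =1 id}.
Proof. by move=> f; rewrite /fps_inv => nUf; rewrite ifN. Qed.

HB.instance Definition _ := GRing.ComNzRing_hasMulInverse.Build {fps R}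
  fps_mulVf fps_unitP fps_inv_out.

End FpsUnitRing.

Section FpsSum.
Variable R : comNzRingType.

(* Coefficientwise sum over n >= a of a family in R[[x]].  The finitely
   supported sum \sum_(n \in A) is 0 by convention on an infinite support, so
   the sum is meaningful for families that are locally finite: every
   coefficient vanishes for all but finitely many n (see fps_sumE). *)
Definition fps_sum (a : nat) (F : nat -> {fps R}) : {fps R} :=
  Fps (fun k => \sum_(n \in [set n | (a <= n)%N]%classic) F n k).

Lemma fps_sumE a b (F : nat -> {fps R}) k :
  (forall n, (b <= n)%N -> F n k = 0) ->
  fps_sum a F k = \sum_(a <= n < b) F n k.
Proof.
move=> F0; rewrite /= (fsbigE (index_iota a b)) ?iota_uniq //=.
- rewrite big_seq_cond [RHS]big_seq; apply: eq_bigl => n.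
  rewrite mem_index_iota; case: (leqP a n) => //= an.
  by rewrite (mem_set (an : [set i | (a <= i)%N]%classic n)) andbT.
- by move=> n /=; rewrite mem_index_iota => /andP[].
- by move=> n an; rewrite mem_index_iota an -leqNgt => /F0.
Qed.

End FpsSum.

(* {fps {fps R}} is R[[x]][[t]]: for F of this type, F k is the coefficient of
   t^k, a power series in x, and F k i the coefficient of t^k x^i. *)
Section Bivariate.
Variable R : comUnitRingType.
Implicit Types F G : {fps {fps R}}.

Definition var_t : {fps {fps R}} := fpsX.
Definition var_x : {fps {fps R}} := fpsC fpsX.

Definition fps_sum2 (a : nat) (F : nat -> {fps {fps R}}) : {fps {fps R}} :=
  Fps (fun k => fps_sum a (fun n => F n k)).

(* Hadamard product in t, ordinary multiplication in R[[x]]. *)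
Definition hadamard F G : {fps {fps R}} := Fps (fun k => F k * G k).
Definition hadamard_pow F n : {fps {fps R}} :=
  iter n (hadamard F) (1 - var_t)^-1.

Definition u_ser : {fps {fps R}} := 4%:R * var_t / (1 + var_t) ^+ 2.
Definition z_ser : {fps {fps R}} := (1 + var_t) * var_x / (1 - var_t).

End Bivariate.

(* The polynomial variable s of Q[s], as an element of Q[s][[x]][[t]]. *)
Definition var_s : {fps {fps {poly rat}}} := fpsC (fpsC 'X).

(* One-line notation, with letters in {1, ..., n}; its positions, like those of
   every seq below, are numbered from 0. *)
Definition word n (pi : 'S_n) : seq nat :=
  [seq (pi i : nat).+1 | i <- enum 'I_n].

(* Sends each letter to its rank, when the letters are distinct. *)
Definition std (w : seq nat) : seq nat :=
  [seq count (fun b => (b <= a)%N) w | a <- w].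

(* n.+1 - m is truncated, so there is no window when n < m. *)
Definition occ m (sigma : 'S_m) n (pi : 'S_n) : nat :=
  #|[set i : 'I_(n.+1 - m) | std (take m (drop i (word pi))) == word sigma]|.

Definition left_peak n (pi : 'S_n) (i : nat) : bool :=
  let p j := nth 0%N (word pi) j in
  [&& (0 < i)%N, (i.+1 < n)%N, (p i.-1 < p i)%N & (p i.+1 < p i)%N]
  || [&& i == 0%N, (2 <= n)%N & (p 1 < p 0)%N].

Definition lpk n (pi : 'S_n) : nat := #|[set i : 'I_n | left_peak pi i]|.

Definition ilpk n (pi : 'S_n) : nat := lpk (pi^-1)%g.

Definition decr_perm m : 'S_m := perm (@rev_ord_inj m).

(* P_{sigma,n}^{ilpk}(s, t), evaluated at elements of any commutative ring. *)
Definition Pilpk (A : comNzRingType) m (sigma : 'S_m) (n : nat) (s t : A) : A :=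
  if n == 0%N then 1 else \sum_(pi : 'S_n) s ^+ occ sigma pi * t ^+ ilpk pi.

(* At s = 0, 0 ^+ 0 = 1 keeps exactly the permutations avoiding sigma. *)
Definition Pilpk0 (A : comNzRingType) m (sigma : 'S_m) (n : nat) (t : A) : A :=
  Pilpk sigma n 0 t.

(* The truncated subtractions are exact for m >= 2 and j, k >= 1. *)
Definition e_coef (m j k : nat) : nat :=
  (4 * \sum_(1 <= l < k.+1) 'C(l + j * m - 1, l - 1) * 'C(j * m - 2, k - l))%N.

Definition e'_coef (m j k : nat) : nat :=
  (4 * \sum_(1 <= l < k.+1) 'C(l + j * m, l - 1) * 'C(j * m - 1, k - l))%N.

(* Main.v *)
(** Words over the letters 0 < -1 < 1 < ... < -k < k, in which two equal letters
    count as a descent exactly when they are negative, are counted in two ways.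

    Standardization: a word of length n is a permutation pi, with the same
    descents, together with a weakly increasing sequence that is compatible with
    the descents of pi^-1 (a left enriched P-partition).  By induction on the
    length n, the number of such sequences is the coefficient of t^k in
    r^n u^(ilpk pi) / (1 - t), with r = (1 + t) / (1 - t), so that
    \sum_w s^(occ w) x^|w| is the coefficient of t^k of the left-hand side.

    Gessel's run theorem: if 1 / (1 - a(y)) is the generating function of the
    weights of the descending runs, then the same sum is 1 / (1 - F_k), where
    F_k = \sum_l a_l d_l x^l and d_l is the number of descending words of length
    l.  The number d_l is again a coefficient of r^l u^[l >= 2] / (1 - t), and so
    F_k is the coefficient of t^k of the argument of the Hadamard powers, whose
    sum has coefficients 1 / (1 - F_k).  Part (b) is the case s = 0, and (c)
    follows by expanding F_k with the binomial series. *)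

From HB Require Import structures.
Require Import Defs.
From mathcomp Require Import all_boot all_order all_algebra all_fingroup.
From mathcomp Require Import zify ring.

Set Implicit Arguments.
Unset Strict Implicit.
Unset Printing Implicit Defensive.

Import GRing.Theory.

Local Open Scope ring_scope.

(** * Power series *)

Section FpsCoef.
Variable R : comNzRingType.
Implicit Types (f g : {fps R}) (c : R).

Lemma coef_fpsN f n : (- f) n = - f n. Proof. by []. Qed.
Lemma coef_fpsD f g n : (f + g) n = f n + g n. Proof. by []. Qed.
Lemma coef_fpsM f g n : (f * g) n = \sum_(i < n.+1) f i * g (n - i)%N.
Proof. by []. Qed.

Lemma coef_fps1 n : (1 : {fps R}) n = (n == 0%N)%:R.
Proof. by rewrite /=; case: (n == 0%N). Qed.

Lemma coef_fps_sum I (r : seq I) (P : pred I) (F : I -> {fps R}) n :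
  (\sum_(i <- r | P i) F i) n = \sum_(i <- r | P i) F i n.
Proof. exact: (big_morph (fun f : {fps R} => f n)). Qed.

Lemma fpsC_is_zmod_morphism : zmod_morphism (@fpsC R).
Proof. by move=> a b; apply/fpsP => n /=; case: eqP => // _; rewrite subr0. Qed.
HB.instance Definition _ :=
  GRing.isZmodMorphism.Build R {fps R} (@fpsC R) fpsC_is_zmod_morphism.

Lemma coef_fpsCM c f n : (fpsC c * f) n = c * f n.
Proof.
rewrite coef_fpsM big_ord_recl /= subn0 big1 ?addr0 // => i _.
by rewrite /= mul0r.
Qed.

Lemma fpsC_is_monoid_morphism : monoid_morphism (@fpsC R).
Proof.
split=> // a b; apply/fpsP => n; rewrite coef_fpsCM /=.
by case: eqP => // _; rewrite mulr0.
Qed.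
HB.instance Definition _ :=
  GRing.isMonoidMorphism.Build R {fps R} (@fpsC R) fpsC_is_monoid_morphism.

Lemma coef_fpsXM f n : (fpsX * f) n = if n is n'.+1 then f n' else 0.
Proof.
case: n => [|n]; first by rewrite coef_fpsM big_ord1 /= mul0r.
rewrite coef_fpsM 2!big_ord_recl /= mul0r add0r mul1r big1 ?addr0 => [|i _].
  by rewrite /bump /= subSS subn0.
by rewrite /= mul0r.
Qed.

Lemma coef_fpsXnM f d n :
  (fpsX ^+ d * f) n = if (d <= n)%N then f (n - d)%N else 0.
Proof.
elim: d n => [|d IHd] n; first by rewrite mul1r subn0.
by rewrite exprS -mulrA coef_fpsXM; case: n => // n; rewrite IHd.
Qed.

Lemma coef_fpsXn d n : ((fpsX : {fps R}) ^+ d) n = (n == d)%:R.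
Proof.
rewrite -[_ ^+ _]mulr1 coef_fpsXnM coef_fps1 subn_eq0.
by rewrite [n == d]eqn_leq andbC; case: (d <= n)%N.
Qed.

Lemma coef_fps0M f g : (f * g) 0%N = f 0%N * g 0%N.
Proof. by rewrite coef_fpsM big_ord1. Qed.

Lemma coef_fps0X f n : (f ^+ n) 0%N = f 0%N ^+ n.
Proof. by elim: n => // n IHn; rewrite !exprS coef_fps0M IHn. Qed.

Lemma coef_fpsX_small f n k : f 0%N = 0 -> (k < n)%N -> (f ^+ n) k = 0.
Proof.
move=> f0; elim: n k => // n IHn k lt_kn; rewrite exprS coef_fpsM big1 // => i _.
have [-> | i_gt0] := posnP i; first by rewrite f0 mul0r.
by rewrite IHn ?mulr0 //; have := ltn_ord i; lia.
Qed.

End FpsCoef.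

Section FpsUnits.
Variable R : comUnitRingType.
Implicit Types f g : {fps R}.

Lemma fps_unitE f : (f \is a GRing.unit) = (f 0%N \is a GRing.unit).
Proof. by []. Qed.

Lemma fps_unit1 f : f 0%N = 1 -> f \is a GRing.unit.
Proof. by rewrite fps_unitE => ->; apply: unitr1. Qed.

Lemma coef_fps_geo n : ((1 - fpsX : {fps R})^-1) n = 1.
Proof.
have <- : Fps (fun=> 1 : R) = (1 - fpsX)^-1; last by [].
have U : (1 - fpsX : {fps R}) \is a GRing.unit.
  by apply: fps_unit1; rewrite /= subr0.
apply: (mulrI U); rewrite divrr //; apply/fpsP => k.
rewrite mulrBl mul1r coef_fpsD coef_fpsN coef_fpsXM coef_fps1.
by case: k => [|k] /=; rewrite ?subr0 ?subrr.
Qed.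

(** Since [f] has no constant term, only the powers [f ^+ n] with n <= k reach degree k, and the
    finite geometric sum telescopes. *)
Lemma fps_geometric f :
  f 0%N = 0 -> fps_sum 0 (fun n => f ^+ n) = (1 - f)^-1.
Proof.
move=> f0; have U : 1 - f \is a GRing.unit.
  by apply: fps_unit1; rewrite /= f0 subr0.
apply: (mulrI U); rewrite divrr //; apply/fpsP => k.
transitivity (((1 - f) * \sum_(0 <= n < k.+1) f ^+ n) k).
  rewrite !coef_fpsM; apply: eq_bigr => i _; congr (_ * _).
  rewrite coef_fps_sum (@fps_sumE _ 0 k.+1) // => n lt_kn.
  by apply: coef_fpsX_small => //; lia.
rewrite big_mkord -opprB mulNr -subrX1 opprB coef_fpsD coef_fpsN.
by rewrite (coef_fpsX_small f0) ?subr0.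
Qed.

End FpsUnits.

Section Hadamard.
Variable R : comUnitRingType.

(** The Hadamard unit 1 / (1 - t) has all its coefficients in t equal to 1, so at each fixed k the
    Hadamard powers are ordinary powers in R[[x]]. *)
Lemma hadamard_powE (F : {fps {fps R}}) n k : hadamard_pow F n k = F k ^+ n.
Proof.
elim: n => [|n IHn]; first by rewrite [LHS]coef_fps_geo.
by rewrite [LHS]/= IHn exprS.
Qed.

(** The vanishing constant term in x makes the family of powers locally finite, so that [fps_sum]
    has its intended meaning. *)
Lemma fps_sum2_hadamard_pow (F : {fps {fps R}}) k :
  F k 0%N = 0 -> fps_sum2 0 (fun n => hadamard_pow F n) k = (1 - F k)^-1.
Proof.
move=> F0; rewrite -fps_geometric //; congr (fps_sum 0 _).
by apply/boolp.funext => n; apply: hadamard_powE.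
Qed.

End Hadamard.

(** * Series in x over R[[t]], where z becomes a multiple of x *)

Section Swap.
Variable R : comNzRingType.

(* Exchanges the two variables: R[[x]][[t]] -> R[[t]][[x]]. *)
Definition fps_swap (F : {fps {fps R}}) : {fps {fps R}} :=
  Fps (fun i => Fps (fun k => F k i)).

Lemma fps_swapE F i k : fps_swap F i k = F k i. Proof. by []. Qed.

Lemma fps_swap_is_zmod_morphism : zmod_morphism fps_swap.
Proof. by move=> F G; apply/fpsP => i; apply/fpsP. Qed.
HB.instance Definition _ :=
  GRing.isZmodMorphism.Build _ _ fps_swap fps_swap_is_zmod_morphism.

Lemma fps_swap_is_monoid_morphism : monoid_morphism fps_swap.
Proof.
split=> [|F G]; apply/fpsP => i; apply/fpsP => k.
  by rewrite fps_swapE /=; case: k => [|k]; case: i.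
rewrite fps_swapE !coef_fpsM !coef_fps_sum.
under eq_bigr do rewrite coef_fpsM.
exact: exchange_big.
Qed.
HB.instance Definition _ :=
  GRing.isMonoidMorphism.Build _ _ fps_swap fps_swap_is_monoid_morphism.

Lemma fps_swapCX : fps_swap (fpsC fpsX) = fpsX.
Proof.
by apply/fpsP => i; apply/fpsP => k /=; case: k => [|k]; case: i => [|[|i]].
Qed.

Lemma fps_swapX : fps_swap fpsX = fpsC fpsX.
Proof.
by apply/fpsP => i; apply/fpsP => k /=; case: k => [|[|k]]; case: i => [|i].
Qed.

Lemma fps_swapCC (c : R) : fps_swap (fpsC (fpsC c)) = fpsC (fpsC c).
Proof. by apply/fpsP => i; apply/fpsP => k /=; case: k; case: i. Qed.

End Swap.

Section Dilate.
Variables (R : comNzRingType) (r : {fps R}).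

(* The substitution f(y) |-> f(r(t) x). *)
Definition fps_dilate (f : {fps R}) : {fps {fps R}} :=
  Fps (fun n => fpsC (f n) * r ^+ n).

Lemma fps_dilateE f n : fps_dilate f n = fpsC (f n) * r ^+ n. Proof. by []. Qed.

Lemma fps_dilate_is_zmod_morphism : zmod_morphism fps_dilate.
Proof. by move=> f g; apply/fpsP => n /=; rewrite rmorphB mulrBl. Qed.
HB.instance Definition _ :=
  GRing.isZmodMorphism.Build _ _ fps_dilate fps_dilate_is_zmod_morphism.

Lemma fps_dilate_is_monoid_morphism : monoid_morphism fps_dilate.
Proof.
split=> [|f g]; apply/fpsP => n.
  rewrite [LHS]/= coef_fps1; case: n => [|n] /=; first exact: mulr1.
  by rewrite rmorph0 mul0r.
rewrite [LHS]/= rmorph_sum mulr_suml coef_fpsM; apply: eq_bigr => i _.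
have -> : r ^+ n = r ^+ i * r ^+ (n - i) by rewrite -exprD subnKC // -ltnS.
by rewrite rmorphM /=; ring.
Qed.
HB.instance Definition _ :=
  GRing.isMonoidMorphism.Build _ _ fps_dilate fps_dilate_is_monoid_morphism.

Lemma fps_dilateX : fps_dilate fpsX = fpsC r * fpsX.
Proof.
apply/fpsP => n; rewrite coef_fpsCM /= rmorph_nat.
by case: n => [|[|n]] /=; rewrite ?expr1 ?mul1r ?mulr1 ?mul0r ?mulr0.
Qed.

Lemma fps_dilateC c : fps_dilate (fpsC c) = fpsC (fpsC c).
Proof.
apply/fpsP => n /=; case: n => [|n] /=; first by rewrite mulr1.
by rewrite rmorph0 mul0r.
Qed.

End Dilate.

(** * Words and left enriched P-partitions *)

Section SumWords.
Variables (A : finType) (R : comNzRingType).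
Implicit Types g h : seq A -> R.

(** The recursion on the first letter lets a word be split at any place without casts between tuple
    types. *)
Fixpoint sum_words n g : R :=
  if n is n'.+1 then \sum_(a : A) sum_words n' (fun w => g (a :: w)) else g [::].

Lemma sum_wordsE n g : \sum_(w : n.-tuple A) g w = sum_words n g.
Proof.
elim: n g => [|n IHn] g /=.
  rewrite (eq_bigr (fun=> g [::])) => [|w _]; last by rewrite tuple0.
  by rewrite sumr_const card_tuple expn0 mulr1n.
under [RHS]eq_bigr do rewrite -IHn.
rewrite pair_bigA /= (reindex (fun p : A * n.-tuple A => [tuple of p.1 :: p.2])) //=.
exists (fun w => (thead w, [tuple of behead w])) => [[a w] _ | w _] /=.
  by congr (_, _); apply: val_inj.
by rewrite -tuple_eta.
Qed.

Lemma eq_sum_words n g h :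
  (forall w, size w = n -> g w = h w) -> sum_words n g = sum_words n h.
Proof.
elim: n g h => [|n IHn] g h gh /=; first exact: gh.
by apply: eq_bigr => a _; apply: IHn => w sz_w; apply: gh; rewrite /= sz_w.
Qed.

Lemma sum_words_cat m n g :
  sum_words (m + n) g = sum_words m (fun u => sum_words n (fun v => g (u ++ v))).
Proof.
by elim: m g => [|m IHm] g //=; apply: eq_bigr => a _; rewrite IHm.
Qed.

Lemma sum_words_rcons n g :
  sum_words n.+1 g = sum_words n (fun w => \sum_a g (rcons w a)).
Proof.
elim: n g => [|n IHn] g //.
by apply: eq_bigr => a _; apply: (IHn (fun w => g (a :: w))).
Qed.

Lemma sum_words_sum n I (r : seq I) (P : pred I) (F : I -> seq A -> R) :
  sum_words n (fun w => \sum_(i <- r | P i) F i w)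
  = \sum_(i <- r | P i) sum_words n (F i).
Proof.
elim: n F => [|n IHn] F //=; rewrite exchange_big /=.
by apply: eq_bigr => a _; rewrite -IHn.
Qed.

Lemma sum_wordsMr n g c : sum_words n (fun w => g w * c) = sum_words n g * c.
Proof.
elim: n g => [|n IHn] g //=; rewrite mulr_suml.
by apply: eq_bigr => a _; rewrite IHn.
Qed.

Lemma sum_wordsMl n g c : sum_words n (fun w => c * g w) = c * sum_words n g.
Proof.
rewrite mulrC -sum_wordsMr; apply: eq_sum_words => w _; exact: mulrC.
Qed.

End SumWords.

(* The letters 0 < 1 < 2 < 3 < 4 < ... stand for 0 < -1 < 1 < -2 < 2 < ... of
   left enriched P-partitions: odd letters are the negative ones, and two equal
   letters form a descent exactly when they are negative. *)
Definition chain_step (d : bool) (b c : nat) : bool :=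
  (b < c)%N || ((b == c) && (odd b == d)).

Definition word_desc (a b : nat) : bool := (b < a)%N || ((a == b) && odd a).

Fixpoint chains (D : nat -> bool) n c : nat :=
  if n is n'.+1
  then (\sum_(b < c) chains D n' b + (odd c == D n') * chains D n' c)%N else 1%N.

Section Chains.
Variables (R : comNzRingType) (K : nat).

Lemma sum_lt_eq c (d : bool) (f : nat -> R) : (c < K)%N ->
  \sum_(b < K) ((b < c)%N || ((b == c :> nat) && d))%:R * f b
  = \sum_(b < c) f b + d%:R * f c.
Proof.
move=> lt_cK; rewrite -(subnKC lt_cK) big_split_ord /= big_ord_recr /=.
rewrite ltnn eqxx -addrA; congr (_ + _).
  by apply: eq_bigr => b _; rewrite ltn_ord mul1r.
rewrite big1 ?addr0 // => b _.
suff -> : (c.+1 + b < c)%N || ((c.+1 + b == c) && d) = false by rewrite mul0r.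
by lia.
Qed.

(** The arbitrary weight [g] of the last letter carries the induction: the last step is absorbed
    into a new weight [g'] of the letter before it. *)
Lemma sum_words_chain (D : nat -> bool) n (g : nat -> R) :
  sum_words n.+1 (fun v : seq 'I_K =>
    (\prod_(i < n) (chain_step (D i) (nth 0%N (map val v) i)
                                     (nth 0%N (map val v) i.+1))%:R)
    * g (nth 0%N (map val v) n))
  = \sum_(c < K) (chains D n c)%:R * g c.
Proof.
elim: n g => [|n IHn] g.
  by apply: eq_bigr => c _; rewrite big_ord0.
rewrite sum_words_rcons.
pose g' b := \sum_(a < K) (chain_step (D n) b a)%:R * g a.
transitivity (\sum_(c < K) (chains D n c)%:R * g' c); last first.
  under eq_bigr do rewrite mulr_sumr.
  rewrite exchange_big; apply: eq_bigr => a _ /=.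
  under eq_bigr do rewrite mulrA.
  rewrite -mulr_suml; congr (_ * _); rewrite natrD natrM natr_sum.
  rewrite -(sum_lt_eq _ (fun b => (chains D n b)%:R) (ltn_ord a)).
  apply: eq_bigr => b _.
  rewrite mulrC /chain_step.
  by case: eqP => [->|].
rewrite -IHn; apply: eq_sum_words => w sz_w.
rewrite mulr_sumr; apply: eq_bigr => a _.
rewrite big_ord_recr /= map_rcons !nth_rcons !size_map sz_w ltnn eqxx ltnSn.
rewrite mulrA; congr (_ * _ * _); apply: eq_bigr => i _.
by rewrite !nth_rcons !size_map sz_w !ltnS ltn_ord ltnW.
Qed.

(** Read backwards, a descending path from [a] is a chain that ends in [a] and has only descent
    steps. *)
Lemma sum_words_path n a : (a < K)%N ->
  sum_words n (fun w : seq 'I_K => (path word_desc a (map val w))%:R)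
  = (chains (fun=> true) n a)%:R :> R.
Proof.
elim: n a => [|n IHn] a lt_aK //.
rewrite [RHS]/= eqb_id natrD natrM natr_sum.
rewrite -(sum_lt_eq _ (fun b => (chains (fun=> true) n b)%:R) lt_aK).
apply: eq_bigr => b _; rewrite -IHn // -sum_wordsMl; apply: eq_sum_words => w _.
rewrite -natrM mulnb; congr (_ && _)%:R.
by rewrite /word_desc eq_sym.
Qed.

Lemma sum_words_sorted n :
  sum_words n.+1 (fun w : seq 'I_K => (sorted word_desc (map val w))%:R)
  = (\sum_(c < K) chains (fun=> true) n c)%N%:R :> R.
Proof. by rewrite natr_sum; apply: eq_bigr => a _; rewrite -sum_words_path. Qed.

End Chains.

(* The number of maximal runs of [true] in D 0, ..., D n.-1. *)
Definition num_runs (D : nat -> bool) n : nat :=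
  \sum_(i < n) (D i && ((i == 0%N :> nat) || ~~ D i.-1)).

(** * Generating function of the chains in the size of the alphabet *)

Section ChainSeries.
Variable R : comUnitRingType.
Local Notation t := (fpsX : {fps R}).
Local Notation r := ((1 + t) / (1 - t)).
Local Notation u := (4%:R * t / (1 + t) ^+ 2).

Definition chain_series D n : {fps R} :=
  Fps (fun k => (\sum_(c < (2 * k).+1) chains D n c)%:R).

Lemma unit_1Bt : 1 - t \is a GRing.unit.
Proof. by apply: fps_unit1; rewrite /= subr0. Qed.
Lemma unit_1Dt : 1 + t \is a GRing.unit.
Proof. by apply: fps_unit1; rewrite /= addr0. Qed.

(** Each step multiplies the series by r, and also by u exactly when it opens a run of descents.
    This follows from a linear recursion for the chains ending in even and in odd letters. *)
Lemma chain_seriesE D n :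
  chain_series D n = r ^+ n.+1 * u ^+ num_runs D n / (1 - t).
Proof.
(* [E] and [O] collect the chains that end in the even letter 2k and in the odd letter 2k + 1. *)
pose E D n : {fps R} := Fps (fun k => (chains D n (2 * k))%:R).
pose O D n : {fps R} := Fps (fun k => (chains D n (2 * k).+1)%:R).
(* Passing from k - 1 to k adds the letters 2k - 1 and 2k, hence the factor t in front of [O]. *)
have WEO m : (1 - t) * chain_series D m = E D m + t * O D m.
  apply/fpsP => k; rewrite mulrBl mul1r !coef_fpsD coef_fpsN !coef_fpsXM.
  case: k => [|k] /=; first by rewrite subr0 addr0 muln0 big_ord1.
  rewrite mulnS !add2n 2!big_ord_recr /= 2!natrD; ring.
have EE m : E D m.+1 = chain_series D m - (D m)%:R * E D m.
  apply/fpsP => k; rewrite coef_fpsD coef_fpsN -(rmorph_nat (@fpsC R)) coef_fpsCM /=.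
  rewrite big_ord_recr /= !natrD natrM oddM /=.
  by case: (D m) => /=; ring.
have OE m : t * O D m.+1 = t * chain_series D m
   + (D m)%:R * ((1 - t) * chain_series D m - E D m).
  rewrite WEO addrAC subrr add0r.
  apply/fpsP => k; rewrite coef_fpsD -(rmorph_nat (@fpsC R)) coef_fpsCM !coef_fpsXM.
  case: k => [|k] /=; first by rewrite mulr0 addr0.
  rewrite !natrD natrM oddM /=.
  by case: (D m) => /=; ring.
pose d m := (m != 0)%N && D m.-1.
(* The share of [E] in the total depends only on [d m], whether the last step was a descent. It is
   stated without division, since 2 may not be a unit in [R]. *)
have key m : (1 - t) * chain_series D m = r ^+ m.+1 * u ^+ num_runs D m
   /\ (if d m then 2%:R else 1 + t) * E D m = (1 - t) * chain_series D m.
  elim: m => [|m [IHW IHE]].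
    have E0 : E D 0%N = (1 - t)^-1.
      by apply/fpsP => k; rewrite coef_fps_geo.
    rewrite {2}WEO /num_runs big_ord0 /= !expr1 mulr1 WEO.
    have -> : O D 0%N = (1 - t)^-1 by rewrite -E0.
    by rewrite E0; split; ring.
  have runsS : num_runs D m.+1 = (num_runs D m + (D m && ~~ d m))%N.
    by rewrite /num_runs big_ord_recr /= /d; case: m {IHW IHE}.
  have rD : r * (1 - t) = 1 + t by rewrite divrK // unit_1Bt.
  have uD : u * (1 + t) ^+ 2 = 4%:R * t by rewrite divrK // unitrX // unit_1Dt.
  rewrite runsS exprD exprS (_ : d m.+1 = D m) // WEO EE OE.
  set W := chain_series D m in IHW IHE *; set Em := E D m in IHE *.
  set ru := r ^+ m.+1 * _ in IHW.
  rewrite (_ : _ * (_ * _) = r * u ^+ (D m && ~~ d m) * ru); last by rewrite /ru; ring.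
  rewrite -IHW; move: rD uD; move: ((1 + t) / (1 - t)) (4%:R * t / _) => rr uu rD uD.
  have rW : rr * ((1 - t) * W) = (1 + t) * W by rewrite mulrA rD.
  case: (D m) => /=; split; try ring; last by rewrite mulr1 rW; ring.
  (* A descent opens a new run here. The new total 2W - 2E, multiplied by 1 + t, is 4tW when the
     previous step was not a descent, which produces the factor u. *)
  apply: (mulrI unit_1Dt).
  rewrite (_ : _ - _ + _ = 2%:R * W - 2%:R * Em); last by ring.
  case: (d m) IHE => /= IHE; first by rewrite mulr1 rW IHE; ring.
  transitivity (2%:R * ((1 + t) * W - (1 + t) * Em)); first by ring.
  transitivity (uu * (1 + t) * (rr * ((1 - t) * W))); last by ring.
  rewrite rW IHE; transitivity (uu * (1 + t) ^+ 2 * W); last by ring.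
  by rewrite uD; ring.
by rewrite -(key n).1 mulrC mulKr // unit_1Bt.
Qed.

End ChainSeries.

(** * Standardization *)

Section Windows.
Variable T : Type.
Implicit Types (e : rel T) (w : seq T).

Fixpoint run_len e w : nat :=
  if w is a :: w' then
    if w' is b :: _ then if e a b then (run_len e w').+1 else 1%N else 1%N
  else 0%N.

(* The number of windows of m consecutive letters that are e-sorted. *)
Fixpoint sorted_windows e m w : nat :=
  if w is _ :: w' then ((m <= run_len e w) + sorted_windows e m w')%N else 0%N.

Lemma run_len_cons2 e a b w :
  run_len e [:: a, b & w] = if e a b then (run_len e (b :: w)).+1 else 1%N.
Proof. by []. Qed.

Lemma sorted_windows_cons e m a w :
  sorted_windows e m (a :: w)
  = ((m <= run_len e (a :: w)) + sorted_windows e m w)%N.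
Proof. by []. Qed.

Lemma run_len_size e w : (run_len e w <= size w)%N.
Proof. by elim: w => // a [|b w] //= IHw; case: ifP. Qed.

Lemma leq_run_len e l w : (l <= size w)%N ->
  (l <= run_len e w)%N = sorted e (take l w).
Proof.
elim: w l => [|a w IHw] [|l] //=.
case: w IHw => [|b w] IHw; first by case: l.
rewrite ltnS => le_lw; have := IHw l le_lw; case: l le_lw => [|l] le_lw /=.
  by case: (e a b).
by case: (e a b) => //= <-.
Qed.

(** No sorted window crosses the end of the first run. The L - l letters that remain of that run
    start L - l - (m - 1) windows, truncated at 0. *)
Lemma sorted_windows_drop e m l w : (0 < m)%N -> (l <= run_len e w)%N ->
  sorted_windows e m (drop l w)
  = (run_len e w - l - m.-1 + sorted_windows e m (drop (run_len e w) w))%N.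
Proof.
move=> m_gt0; elim: w l => [|a w IHw] l //.
have [-> _ | ] := posnP l; last first.
  case: l => // l _; case: w IHw => [|b w] IHw.
    by rewrite [run_len _ _]/=; case: l.
  rewrite [run_len e _]/=; case: (e a b) => [|]; first by move/IHw.
  by case: l.
have pos_run k : ((m <= k.+1) + (k - m.-1) = k.+1 - m.-1)%N.
  by case: leqP => /=; lia.
rewrite drop0 subn0 sorted_windows_cons.
case: w IHw => [|b w] IHw; first by rewrite -pos_run /= !addn0.
rewrite run_len_cons2; case: (e a b); last by rewrite /= -pos_run addn0.
have := IHw 0%N (leq0n _); rewrite drop0 subn0 => ->.
by rewrite addnA pos_run.
Qed.

Lemma sorted_windowsE e m w : (0 < m)%N ->
  sorted_windows e m w
  = (\sum_(i < (size w).+1 - m) sorted e (take m (drop i w)))%N.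
Proof.
move=> m_gt0; have le_win : ((size w).+1 - m <= size w)%N by lia.
(* The sum is extended to all positions, those without room for a window counting 0, so that the
   induction on [w] can remove its first letter. *)
rewrite (big_ord_widen _ (fun i => sorted e (take m (drop i w)) : nat) le_win).
rewrite big_mkcond /=; clear le_win; elim: w => [|a w IHw]; first by rewrite big_ord0.
rewrite big_ord_recl sorted_windows_cons IHw; congr (_ + _)%N; last first.
  apply: eq_bigr => i _; rewrite lift0 [drop _ (_ :: _)]/=.
  by rewrite (_ : (i.+1 < _)%N = (i < (size w).+1 - m)%N) //=; lia.
rewrite drop0 subn_gt0 ltnS; case: (leqP m (size (a :: w))) => le_mw.
  by rewrite leq_run_len.
by rewrite leqNgt (leq_ltn_trans (run_len_size e (a :: w)) le_mw).
Qed.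

End Windows.

Lemma eq_run_len (T U : Type) (e : rel T) (f : rel U) x0 y0 w v :
  size w = size v ->
  (forall i, (i.+1 < size w)%N ->
     e (nth x0 w i) (nth x0 w i.+1) = f (nth y0 v i) (nth y0 v i.+1)) ->
  run_len e w = run_len f v.
Proof.
elim: w v => [|a w IHw] [|b v] //= [sz_wv] ef.
have {IHw} IH : run_len e w = run_len f v.
  by apply: IHw => // i lt_iw; apply: (ef i.+1).
case: w v sz_wv ef IH => [|a' w] [|b' v] // _ ef ->.
by rewrite (ef 0%N isT).
Qed.

Lemma eq_sorted_windows (T U : Type) (e : rel T) (f : rel U) x0 y0 m w v :
  size w = size v ->
  (forall i, (i.+1 < size w)%N ->
     e (nth x0 w i) (nth x0 w i.+1) = f (nth y0 v i) (nth y0 v i.+1)) ->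
  sorted_windows e m w = sorted_windows f m v.
Proof.
elim: w v => [|a w IHw] [|b v] // sz_wv ef.
rewrite !sorted_windows_cons (eq_run_len sz_wv ef); congr addn.
by case: sz_wv => sz_wv; apply: IHw => // i lt_iw; apply: (ef i.+1).
Qed.

Lemma word_nth n (pi : 'S_n) (i : 'I_n) : nth 0%N (word pi) i = (pi i).+1.
Proof. by rewrite (nth_map i) ?size_enum_ord // nth_ord_enum. Qed.

Lemma size_word n (pi : 'S_n) : size (word pi) = n.
Proof. by rewrite size_map size_enum_ord. Qed.

Lemma word_decr_perm m : word (decr_perm m) = [seq (m - i)%N | i <- iota 0 m].
Proof.
rewrite -val_enum_ord -map_comp; apply: eq_map => i /=.
by rewrite permE /=; have := ltn_ord i; lia.
Qed.

(** If some letter were at most its right neighbour, its rank would be at most that of the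
    neighbour, against the ranks [size u], ..., 1. Conversely, the first letter of a decreasing word
    has rank [size u] and is not counted in the later ranks. *)
Lemma std_decr_perm u :
  (std u == word (decr_perm (size u))) = sorted gtn u.
Proof.
rewrite word_decr_perm; apply/eqP/idP => [std_u | ].
  apply/(sortedP 0%N) => i lt_iu; rewrite /gtn /= ltnNge; apply/negP => le_uu.
  have st_nth j : (j < size u)%N ->
      count (fun b => b <= nth 0%N u j)%N u = (size u - j)%N.
    move=> lt_ju; have /(congr1 (nth 0%N ^~ j)) := std_u.
    by rewrite /std /= !(nth_map 0%N) ?size_iota // nth_iota.
  have : (count (fun b => b <= nth 0 u i) u <= count (fun b => b <= nth 0 u i.+1) u)%N.
    by apply: sub_count => b /= /leq_trans; apply.
  by rewrite !st_nth // ?(ltnW lt_iu) //; lia.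
elim: u => // a u IHu; rewrite /= (path_sortedE (rev_trans ltn_trans)).
case/andP => /allP lt_ua sorted_u; rewrite /std /= leqnn -[RHS]/(_ :: _).
congr (_ :: _).
  suff -> : count (fun b => b <= a)%N u = size u by [].
  by apply/eqP; rewrite -all_count; apply/allP => b /lt_ua /ltnW.
have -> : [seq ((size u).+1 - i)%N | i <- iota 1 (size u)]
          = [seq (size u - i)%N | i <- iota 0 (size u)].
  by rewrite (iotaDl 1 0) -map_comp.
rewrite -IHu //; apply/eq_in_map => b /lt_ua lt_ba /=.
by rewrite leqNgt (lt_ba : (b < a)%N).
Qed.

Lemma occ_decr_perm m n (pi : 'S_n) : (0 < m)%N ->
  occ (decr_perm m) pi = sorted_windows gtn m (word pi).
Proof.
move=> m_gt0; rewrite sorted_windowsE // size_word /occ -sum1_card.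
rewrite big_mkcond; apply: eq_bigr => i _; rewrite inE -std_decr_perm.
suff -> : size (take m (drop i (word pi))) = m by case: eqP.
by rewrite size_take_min size_drop size_word; have := ltn_ord i; lia.
Qed.

Definition perm_desc n (tau : 'S_n) (i : nat) : bool :=
  (nth 0%N (word tau) i.+1 < nth 0%N (word tau) i)%N.

(** A left peak is the position of the first descent in a maximal run of descents. *)
Lemma lpk_num_runs n (tau : 'S_n.+1) : lpk tau = num_runs (perm_desc tau) n.
Proof.
rewrite /lpk -sum1_card big_mkcond /num_runs.
under eq_bigr do rewrite inE.
(* The last position is never a left peak. *)
rewrite big_ord_recr /= {2}/left_peak ltnn !andbF /=.
rewrite (_ : _ && _ = false) ?addn0; last by apply/negP => /and3P[/eqP]; lia.
apply: eq_bigr => i _; rewrite -[LHS]/(nat_of_bool (left_peak tau i)).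
congr nat_of_bool; rewrite /left_peak /perm_desc.
have -> : (i.+1 < n.+1)%N by rewrite ltnS ltn_ord.
case: i => [[|i] lt_in] /=; first by rewrite andbT ltnS (leq_ltn_trans _ lt_in).
rewrite orbF andbC -leqNgt [(nth _ _ i <= nth _ _ i.+1)%N]leq_eqVlt.
(* As the letters are distinct, a step that is not a descent is a strict ascent. *)
rewrite nth_uniq ?size_word; try lia.
by rewrite map_inj_uniq ?enum_uniq // => x y [] /val_inj /perm_inj.
Qed.

Lemma card_perm_lt n (pi : 'S_n) i : #|[set j | pi j < pi i]%N| = pi i.
Proof.
rewrite -(card_imset _ (@perm_inj _ pi)) (_ : _ @: _ = [set k : 'I_n | k < pi i]%N).
  rewrite -sum1_card big_mkcond; under eq_bigr do rewrite inE.
  rewrite -big_mkcond -(big_ord_widen _ (fun=> 1%N)) ?(ltnW (ltn_ord _)) //.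
  by rewrite sum1_card card_ord.
apply/setP => k; rewrite inE; apply/imsetP/idP => [[j] | lt_k].
  by rewrite inE => ? ->.
by exists ((pi^-1)%g k); rewrite ?inE permKV.
Qed.

(** The permutation sends [i] to the number of smaller keys; it is unique because the relative order
    of its values determines a permutation. *)
Lemma perm_of_key n (key : 'I_n -> nat) : injective key ->
  exists pi0 : 'S_n, forall pi : 'S_n,
    [forall i, forall j, (pi i < pi j)%N == (key i < key j)%N] = (pi == pi0).
Proof.
move=> key_inj; pose rk i := #|[set j | key j < key i]%N|.
have rk_lt i : (rk i < n)%N.
  rewrite -[X in (_ < X)%N]card_ord; apply: proper_card.
  by apply/properP; split; [apply/subsetP | exists i; rewrite // inE ltnn].
have rk_mono i j : (key i < key j)%N -> (rk i < rk j)%N.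
  move=> lt_ij; apply: proper_card; apply/properP; split.
    by apply/subsetP => k; rewrite !inE => /ltn_trans; apply.
  by exists i; rewrite inE // ltnn.
have rk_monoE i j : (rk i < rk j)%N = (key i < key j)%N.
  case: (ltngtP (key i) (key j)) => [/rk_mono -> // | /rk_mono lt_ji | /key_inj ->].
    by rewrite ltnNge ltnW.
  by rewrite ltnn.
have rk_inj : injective (fun i => Ordinal (rk_lt i)).
  move=> i j /(congr1 val) /= rk_ij; apply: key_inj.
  by case: (ltngtP (key i) (key j)) => // /rk_mono; rewrite rk_ij ltnn.
exists (perm rk_inj) => pi; apply/idP/eqP => [/forallP key_pi | ->].
  apply/permP => i; rewrite permE; apply: val_inj.
  rewrite /= -card_perm_lt; apply: eq_card => j; rewrite !inE.
  by have /forallP/(_ i)/eqP := key_pi j.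
by apply/forallP => i; apply/forallP => j; rewrite !permE /= rk_monoE.
Qed.

(* Orders the occurrences (letter a, position p) of a word of length n: by
   letter, then from left to right for even letters and from right to left for
   odd ones. *)
Definition letter_key n (a p : nat) : nat :=
  (a * n + (if odd a then n - p.+1 else p))%N.

Lemma letter_key_lt n a b p q : (p < n)%N -> (q < n)%N ->
  (letter_key n a p < letter_key n b q)%N
  = (a < b)%N || (a == b) && (if odd a then (q < p)%N else (p < q)%N).
Proof.
move=> lt_pn lt_qn; rewrite /letter_key.
case: (ltngtP a b) => [lt_ab | lt_ba | ->] /=.
- have : (a.+1 * n <= b * n)%N by rewrite leq_mul2r lt_ab orbT.
  by rewrite mulSn; case: (odd a); case: (odd b); lia.
- have : (b.+1 * n <= a * n)%N by rewrite leq_mul2r lt_ba orbT.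
  by rewrite mulSn; case: (odd a); case: (odd b); lia.
- by case: (odd b); lia.
Qed.

Lemma letter_key_inj n a b p q : (p < n)%N -> (q < n)%N ->
  letter_key n a p = letter_key n b q -> p = q.
Proof.
move=> lt_pn lt_qn key_eq.
have := letter_key_lt a b lt_pn lt_qn; have := letter_key_lt b a lt_qn lt_pn.
by rewrite key_eq ltnn; case: (ltngtP a b) => // ->; case: (odd b) => /=; lia.
Qed.


Section SumStandardization.
Variables (R : comNzRingType) (K n : nat).
Implicit Types (pi : 'S_n.+1) (w v : n.+1.-tuple 'I_K).

Let key w (i : 'I_n.+1) : nat := letter_key n.+1 (tnth w i) i.
Let standardizes pi w : bool :=
  [forall i, forall j, (pi i < pi j)%N == (key w i < key w j)%N].

Lemma key_inj w : injective (key w).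
Proof. by move=> i j /(letter_key_inj (ltn_ord i) (ltn_ord j)) /val_inj. Qed.

Lemma nth_val_tuple w (i : 'I_n.+1) : nth 0%N (map val w) i = tnth w i.
Proof.
by rewrite (nth_map (tnth w i)) ?size_tuple ?ltn_ord // -tnth_nth.
Qed.

(** Equal odd letters are numbered from right to left, so two equal neighbours form a descent of
    [pi] exactly when they are odd. *)
Lemma standardizes_windows m pi w : standardizes pi w ->
  sorted_windows gtn m (word pi) = sorted_windows word_desc m (map val w).
Proof.
move=> std_w; apply: (@eq_sorted_windows _ _ _ _ 0%N 0%N).
  by rewrite size_word size_map size_tuple.
rewrite size_word => i lt_in.
pose i0 := Ordinal (ltnW lt_in); pose i1 := Ordinal lt_in.
rewrite (word_nth pi i0 : nth _ _ i = _) (word_nth pi i1 : nth _ _ i.+1 = _).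
rewrite (nth_val_tuple w i0 : nth _ _ i = _) (nth_val_tuple w i1 : nth _ _ i.+1 = _).
rewrite /word_desc /gtn /= ltnS.
have /forallP/(_ i1)/forallP/(_ i0)/eqP -> := std_w.
rewrite letter_key_lt ?ltn_ord //= ltnSn (ltn_geF (ltnW (ltnSn i.+1))).
by rewrite (eq_sym (tnth w i0 : nat)); case: eqP => [->|] //; case: (odd _).
Qed.

(** Here [v] lists the letters of the word by increasing rank. The word standardizes to [pi] iff the
    keys increase along [v], and an equality of neighbours in [v] is allowed iff its parity agrees
    with the descent of the inverse of [pi] there. *)
Lemma standardizes_chain pi v :
  (standardizes pi [tuple tnth v (pi i) | i < n.+1])%:R
  = \prod_(i < n) (chain_step (perm_desc pi^-1 i) (nth 0%N (map val v) i)
                                         (nth 0%N (map val v) i.+1))%:R :> R.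
Proof.
(* The key of the letter that has rank [j]. *)
pose kappa (j : 'I_n.+1) := letter_key n.+1 (tnth v j) (pi^-1 j)%g.
have key_kappa i : key [tuple tnth v (pi j) | j < n.+1] i = kappa (pi i).
  by rewrite /key /kappa tnth_mktuple permK.
have stepE (i : 'I_n) : chain_step (perm_desc pi^-1 i) (nth 0%N (map val v) i)
    (nth 0%N (map val v) i.+1) = (kappa (inord i) < kappa (inord i.+1))%N.
  have e0 : (inord i : 'I_n.+1) = i :> nat by rewrite inordK // ltnS ltnW.
  have e1 : (inord i.+1 : 'I_n.+1) = i.+1 :> nat by rewrite inordK // ltnS.
  move: e0 e1; set i0 := inord i; set i1 := inord i.+1 => e0 e1.
  have : (pi^-1 i0 != pi^-1 i1)%g.
    by rewrite (inj_eq perm_inj) -val_eqE /= e0 e1 neq_ltn ltnSn.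
  rewrite /perm_desc -e1 -e0 !word_nth !nth_val_tuple ltnS letter_key_lt ?ltn_ord //.
  rewrite -val_eqE /chain_step; move: (pi^-1 i0)%g (pi^-1 i1)%g => p q ne_pq.
  by congr (_ || (_ && _)); case: (odd _); case: (ltngtP p q) ne_pq.
have -> : standardizes pi [tuple tnth v (pi j) | j < n.+1]
    = [forall i : 'I_n, (kappa (inord i) < kappa (inord i.+1))%N].
  apply/idP/forallP => [std_v i | lt_kappa].
    have /forallP/(_ (pi^-1 (inord i))%g)/forallP/(_ (pi^-1 (inord i.+1))%g) := std_v.
    rewrite !key_kappa !permKV => /eqP <-.
    by rewrite !inordK ?ltnS // ltnW.
  (* Comparing consecutive ranks suffices, by transitivity. *)
  have kappa_mono (i j : 'I_n.+1) : (i < j)%N -> (kappa i < kappa j)%N.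
    case: j => j lt_jn /=; elim: j lt_jn => // j IHj lt_jn.
    have lt_step := lt_kappa (Ordinal (lt_jn : (j < n)%N)).
    have ej : Ordinal (ltnW lt_jn) = inord j.
      by apply: val_inj; rewrite /= inordK // ltnW.
    have -> : Ordinal lt_jn = inord j.+1 by apply: val_inj; rewrite /= inordK.
    rewrite ltnS leq_eqVlt => /orP[/eqP eq_ij | /(IHj (ltnW lt_jn))].
      by rewrite (_ : i = inord j) // -ej; apply: val_inj.
    by rewrite ej => /ltn_trans; apply.
  apply/forallP => i; apply/forallP => j; rewrite !key_kappa.
  case: (ltngtP (pi i) (pi j)) => [/kappa_mono -> // | /kappa_mono lt_ji | /val_inj ->].
    by rewrite ltnNge ltnW.
  by rewrite ltnn.
under [RHS]eq_bigr do rewrite stepE.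
have [/forallP all_steps | /forallPn[i /negPf not_step]] :=
  boolP [forall i : 'I_n, (kappa (inord i) < kappa (inord i.+1))%N].
  by rewrite big1 // => i _; rewrite all_steps.
by rewrite (bigD1 i) //= not_step mul0r.
Qed.

(** Every word has exactly one standardization [pi], which has the same decreasing windows; the
    words with a given [pi] are then counted as chains. *)
Lemma sum_words_standardization m (s : R) : (0 < m)%N ->
  sum_words n.+1 (fun w : seq 'I_K => s ^+ sorted_windows word_desc m (map val w))
  = \sum_(pi : 'S_n.+1) s ^+ occ (decr_perm m) pi
      * (\sum_(c < K) chains (perm_desc pi^-1) n c)%N%:R.
Proof.
move=> m_gt0; rewrite -sum_wordsE.
transitivity (\sum_(w : n.+1.-tuple 'I_K) \sum_(pi : 'S_n.+1)
    s ^+ occ (decr_perm m) pi * (standardizes pi w)%:R).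
  apply: eq_bigr => w _; have [pi0 std_pi0] := perm_of_key (@key_inj w).
  rewrite (bigD1 pi0) //= big1 ?addr0 => [|pi ne_pi].
    have std0 : standardizes pi0 w by rewrite /standardizes std_pi0.
    by rewrite std0 mulr1 occ_decr_perm // (standardizes_windows _ std0).
  by rewrite /standardizes std_pi0 (negPf ne_pi) mulr0.
rewrite exchange_big; apply: eq_bigr => pi _.
rewrite -mulr_sumr natr_sum; congr (_ * _).
(* Permuting the positions by [pi] is a bijection between words and their rearrangements [v]. *)
rewrite (reindex (fun v : n.+1.-tuple 'I_K => [tuple tnth v (pi i) | i < n.+1])).
  under eq_bigr do rewrite standardizes_chain.
  have := sum_words_chain K (perm_desc pi^-1) n (fun=> 1 : R).
  under [RHS]eq_bigr do rewrite mulr1.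
  move=> <-; rewrite -sum_wordsE; apply: eq_bigr => v _; rewrite mulr1.
  by [].
exists (fun w => [tuple tnth w (pi^-1 i)%g | i < n.+1]) => v _;
  by apply: eq_from_tnth => i; rewrite !tnth_mktuple ?permK ?permKV.
Qed.

End SumStandardization.

(** * The run theorem and the main identity *)

Section RunTheorem.
Variables (R : comNzRingType) (A : finType) (T : Type) (f : A -> T) (e : rel T).
Variables (s : R) (m : nat) (a : {fps R}).
Hypothesis m_gt0 : (0 < m)%N.

(** A run of length l has one factor [s] for each of its l - (m - 1) windows, truncated at 0. The
    next hypothesis says that this series is 1 / (1 - a). *)
Let run_weight : {fps R} := Fps (fun l => s ^+ (l - m.-1)).
Hypothesis run_weightE : run_weight = 1 + a * run_weight.
Hypothesis a0 : a 0%N = 0.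

Let wt (w : seq A) : R := s ^+ sorted_windows e m (map f w).

(** Removing l letters from a first run of length L leaves a run of length L - l and the rest
    unchanged, so this is [run_weightE] in degree L. *)
Lemma weight_first_run w : w != [::] ->
  wt w = \sum_(1 <= l < (size w).+1)
           a l * ((sorted e (map f (take l w)))%:R * wt (drop l w)).
Proof.
move=> w_neq0; set v := map f w; have sz_v : size v = size w by rewrite size_map.
set L := run_len e v.
have L_gt0 : (0 < L)%N.
  by rewrite /L /v; case: w w_neq0 {v sz_v L} => // x [|y w] _ //=; case: ifP.
have le_Lw : (L <= size w)%N by rewrite -sz_v run_len_size.
pose beta := s ^+ sorted_windows e m (drop L v).
have wt_drop l : (l <= L)%N -> wt (drop l w) = run_weight (L - l)%N * beta.
  by move=> le_lL; rewrite /wt map_drop sorted_windows_drop // exprD.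
rewrite -[w in LHS]drop0 wt_drop // subn0 run_weightE coef_fpsD coef_fps1.
rewrite gtn_eqF // add0r coef_fpsM big_ord_recl a0 mul0r add0r mulr_suml.
(* The terms with l > L vanish: a prefix longer than the first run is not sorted. *)
rewrite (big_cat_nat _ (n := L.+1)) //=.
rewrite [X in _ = _ + X]big_nat_cond [X in _ = _ + X]big1 ?addr0 => [|l]; last first.
  move=> /andP[/andP[lt_Ll le_lw] _].
  by rewrite map_take -leq_run_len ?sz_v // leqNgt lt_Ll mul0r mulr0.
rewrite big_add1 big_mkord; apply: eq_bigr => i _.
rewrite /bump leq0n add1n map_take -leq_run_len ?sz_v ?(leq_trans (ltn_ord i)) //.
by rewrite mul1r wt_drop // mulrA.
Qed.

(* Gessel's run theorem: splitting a word after l of the letters of its first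
   run, with weight a l, accounts for the weight of that run. *)
Lemma run_theorem :
  Fps (fun n => sum_words n wt)
  = 1 + Fps (fun l => a l * sum_words l (fun w => (sorted e (map f w))%:R))
        * Fps (fun n => sum_words n wt).
Proof.
pose d l := sum_words l (fun w => (sorted e (map f w))%:R) : R.
rewrite -[Fps (fun l => a l * _)]/(Fps (fun l => a l * d l)).
apply/fpsP => n; rewrite coef_fpsD coef_fps1 coef_fpsM big_ord_recl /= a0 !mul0r add0r.
case: n => [|n]; first by rewrite big_ord0 addr0.
rewrite add0r (@eq_sum_words _ _ _ _ (fun w => \sum_(1 <= l < n.+2)
   a l * ((sorted e (map f (take l w)))%:R * wt (drop l w)))); last first.
  by move=> w sz_w; rewrite weight_first_run ?sz_w // -size_eq0 sz_w.
rewrite sum_words_sum big_add1 big_mkord; apply: eq_bigr => i _.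
rewrite sum_wordsMl /bump leq0n add1n -mulrA; congr (_ * _).
have {1}-> : n.+1 = (i.+1 + (n.+1 - i.+1))%N by rewrite subnKC.
rewrite sum_words_cat /d -sum_wordsMr; apply: eq_sum_words => u sz_u.
rewrite -sum_wordsMl; apply: eq_sum_words => v _.
by rewrite -sz_u take_size_cat // drop_size_cat.
Qed.

End RunTheorem.

(** * The inverse of the series of run weights *)

Section ClusterSeries.
Variables (R : comUnitRingType) (s : R) (m : nat).
Hypothesis m_gt0 : (0 < m)%N.

(* Determined by 1 / (1 - y - cluster_series) = \sum_l s^(l - (m - 1)) y^l, the
   series of run weights, with truncated exponents. *)
Definition cluster_series : {fps R} :=
  (fpsC s - 1) * fpsX ^+ m / (1 - (fpsC s - 1) * \sum_(1 <= l < m) fpsX ^+ l).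

Lemma cluster_denom_unit :
  1 - (fpsC s - 1) * \sum_(1 <= l < m) fpsX ^+ l \is a @GRing.unit {fps R}.
Proof.
apply: fps_unit1; rewrite coef_fpsD coef_fpsN coef_fps0M coef_fps_sum.
rewrite big_nat big1 ?mulr0 ?subr0 // => l /andP[l_gt0 _].
by rewrite coef_fpsXn eq_sym gtn_eqF.
Qed.

Lemma coef_cluster_series_small n : (n < m)%N -> cluster_series n = 0.
Proof.
by move=> lt_nm; rewrite /cluster_series -mulrA mulrCA coef_fpsXnM leqNgt lt_nm.
Qed.

(** With P = y + ... + y^(m-1) and Q = 1 - (s - 1) P, the series B of run weights satisfies (1 - s
    y) B = Q, while (1 - y) P = y - y^m gives Q (y + [cluster_series]) = Q - (1 - s y). *)
Lemma run_weight_cluster :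
  Fps (fun l => s ^+ (l - m.-1))
  = 1 + (fpsX + cluster_series) * Fps (fun l => s ^+ (l - m.-1)).
Proof.
set B := Fps _; set P := \sum_(1 <= l < m) (fpsX : {fps R}) ^+ l.
have coefP n : P n = (0 < n < m)%N%:R.
  rewrite coef_fps_sum; under eq_bigr do rewrite coef_fpsXn.
  have [n_in | n_notin] := boolP (0 < n < m)%N.
    rewrite (bigD1_seq n) ?mem_index_iota ?iota_uniq //= eqxx big1 ?addr0 //.
    by move=> l ne_ln; rewrite eq_sym (negPf ne_ln).
  rewrite big_nat big1 // => l l_in; case: eqP => // nl.
  by rewrite nl l_in in n_notin.
have PX : P * (1 - fpsX) = fpsX - fpsX ^+ m.
  apply/fpsP => n; rewrite mulrBr mulr1 mulrC.
  rewrite !(coef_fpsD, coef_fpsN) coef_fpsXM coef_fpsXn.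
  case: n => [|n]; rewrite ?coefP /=; first by rewrite ltn_eqF // !subr0.
  rewrite eqSS; case: (ltngtP n.+1 m) => [lt_nm | lt_mn | eq_nm].
  - by rewrite andbT; case: (n) => [|p] /=; ring.
  - by rewrite andbF; case: n lt_mn => [|n] /=; [lia | move=> _; ring].
  - by rewrite andbT; case: (n) => [|p] /=; ring.
have BX : (1 - fpsC s * fpsX) * B = 1 - (fpsC s - 1) * P.
  apply/fpsP => n; rewrite !mulrBl !mul1r -mulrA.
  rewrite !(coef_fpsD, coef_fpsN) !coef_fpsCM coef_fpsXM coef_fps1 coefP.
  case: n => [|n] /=; first by ring.
  case: (ltnP n.+1 m) => [lt_nm | le_mn] /=.
    have -> : (n.+1 - m.-1 = 0)%N by lia.
    have -> : (n - m.-1 = 0)%N by lia.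
    by ring.
  have -> : (n.+1 - m.-1 = (n - m.-1).+1)%N by lia.
  by rewrite exprS; ring.
apply: (mulrI cluster_denom_unit); rewrite mulrDr mulr1 -/P.
set Q := 1 - _ * P in BX *.
have cQ : Q * cluster_series = (fpsC s - 1) * fpsX ^+ m.
  by rewrite [LHS]mulrC; apply: divrK; apply: cluster_denom_unit.
have Xm : fpsX ^+ m = fpsX - P * (1 - fpsX) by rewrite PX; ring.
have QXc : Q * (fpsX + cluster_series) = Q - (1 - fpsC s * fpsX).
  by rewrite mulrDr cQ Xm /Q; ring.
by rewrite mulrA QXc [(Q - _) * B]mulrBl BX; ring.
Qed.

End ClusterSeries.

Section MainIdentity.
Variables (R : comUnitRingType) (s : R) (m : nat).
Hypothesis m_gt1 : (2 <= m)%N.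

Let K := {fps R}.
Let T := {fps {fps R}}.
Local Notation t := (fpsX : K).
Local Notation r := ((1 + t) / (1 - t) : K).
Local Notation u := (4%:R * t / (1 + t) ^+ 2 : K).
Local Notation g := ((1 - t)^-1 : K).
Local Notation S := (fps_dilate r).

Lemma fps_swap_var_t : fps_swap (var_t R) = fpsC t.
Proof. exact: fps_swapX. Qed.

Lemma unit_1Bvar_t : 1 - var_t R \is a GRing.unit.
Proof. exact: (unit_1Bt K). Qed.
Lemma unit_1Dvar_t : 1 + var_t R \is a GRing.unit.
Proof. exact: (unit_1Dt K). Qed.

Lemma fps_swap_1Bt : fps_swap (1 - var_t R) = fpsC (1 - t).
Proof. by rewrite !rmorphB !rmorph1 /= fps_swap_var_t. Qed.
Lemma fps_swap_1Dt : fps_swap (1 + var_t R) = fpsC (1 + t).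
Proof. by rewrite !rmorphD !rmorph1 /= fps_swap_var_t. Qed.

Lemma fps_swapV (F : T) (p : K) : F \is a GRing.unit -> p \is a GRing.unit ->
  fps_swap F = fpsC p -> fps_swap F^-1 = fpsC p^-1.
Proof.
move=> UF Up swapF; have UCp : fpsC p \is a GRing.unit by [].
apply: (mulIr UCp); rewrite -{1}swapF.
rewrite -(rmorphM (@fps_swap R)) -(rmorphM (@fpsC K)).
by rewrite !mulVr // !rmorph1.
Qed.

Lemma fps_swap_1BtV : fps_swap (1 - var_t R)^-1 = fpsC g.
Proof. exact: (fps_swapV unit_1Bvar_t (unit_1Bt R) fps_swap_1Bt). Qed.

(** After the exchange of variables z is r x, so a series f(z) with coefficients in [R] becomes the
    dilation [S f]. *)
Lemma fps_swap_z : fps_swap (z_ser R) = S fpsX.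
Proof.
have -> : z_ser R = (1 + var_t R) * (1 - var_t R)^-1 * var_x R.
  by rewrite /z_ser mulrAC.
rewrite [LHS](rmorphM (@fps_swap R)).
rewrite /= [fps_swap (_ * _)](rmorphM (@fps_swap R)) /=.
rewrite fps_swap_1BtV fps_swap_1Dt [fps_swap (var_x R)]fps_swapCX.
by rewrite fps_dilateX; congr (_ * _); rewrite -(rmorphM (@fpsC K)).
Qed.

Lemma fps_swap_u : fps_swap (u_ser R) = fpsC u.
Proof.
rewrite /u_ser.
have swapV : fps_swap ((1 + var_t R) ^+ 2)^-1 = fpsC ((1 + t) ^+ 2)^-1.
  apply: fps_swapV; rewrite ?unitrX ?unit_1Dvar_t ?unit_1Dt //.
  by rewrite (rmorphXn (@fps_swap R)) /= fps_swap_1Dt -(rmorphXn (@fpsC K)).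
rewrite [LHS](rmorphM (@fps_swap R)) /= swapV.
rewrite [fps_swap (_ * _)](rmorphM (@fps_swap R)) /= fps_swap_var_t.
rewrite (rmorph_nat (@fps_swap R)).
by rewrite (rmorphM (@fpsC K)) /= (rmorphM (@fpsC K)) /= (rmorph_nat (@fpsC K)).
Qed.

Lemma coef_fpsCM_dilate (p : K) (f : {fps R}) n k :
  (fpsC p * S f) n k = f n * (p * r ^+ n) k.
Proof. by rewrite coef_fpsCM fps_dilateE mulrCA coef_fpsCM. Qed.

(** As z^j = r^j x^j and [P j] is free of x, only the summand j = n contributes to x^n; this also
    gives local finiteness. *)
Lemma coef_sum_z_ser (P : nat -> T) (p : nat -> K) n k :
  (forall n, fps_swap (P n) = fpsC (p n)) ->
  fps_sum2 0 (fun n => P n * z_ser R ^+ n) k n = (p n * r ^+ n) k.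
Proof.
move=> swapP.
have termE j : (P j * z_ser R ^+ j) k n = (n == j)%:R * (p j * r ^+ n) k.
  rewrite -coef_fpsXn -coef_fpsCM_dilate -[LHS]fps_swapE.
  congr (fps_coef (fps_coef _ n) k).
  rewrite (rmorphM (@fps_swap R)) /= (rmorphXn (@fps_swap R)) /= swapP fps_swap_z.
  by rewrite -(rmorphXn S).
rewrite [LHS](@fps_sumE _ 0 n.+1) => [|j lt_nj].
  rewrite big_nat_recr //= termE eqxx mul1r big_nat big1 ?add0r // => j /andP[_ lt_jn].
  by rewrite termE gtn_eqF // mul0r.
by rewrite termE ltn_eqF // mul0r.
Qed.

Let sT : T := fpsC (fpsC s).
Local Notation Q := (1 - (sT - 1) * \sum_(1 <= l < m) z_ser R ^+ l).
Local Notation q := (1 - (fpsC s - 1) * \sum_(1 <= l < m) fpsX ^+ l : {fps R}).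

Lemma fps_swap_sB1 : fps_swap (sT - 1) = S (fpsC s - 1).
Proof.
rewrite (rmorphB (@fps_swap R)) (rmorphB S) !rmorph1 /= fps_swapCC.
by rewrite fps_dilateC.
Qed.

Lemma fps_swap_z_exp l : fps_swap (z_ser R ^+ l) = S (fpsX ^+ l).
Proof. by rewrite (rmorphXn (@fps_swap R)) /= fps_swap_z -(rmorphXn S). Qed.

Lemma fps_swap_denom : fps_swap Q = S q.
Proof.
rewrite (rmorphB (@fps_swap R)) (rmorphB S) !rmorph1; congr (_ - _).
rewrite (rmorphM (@fps_swap R)) (rmorphM S) /= fps_swap_sB1; congr (_ * _).
rewrite (rmorph_sum (@fps_swap R)) (rmorph_sum S) /=.
by apply: eq_bigr => l _; apply: fps_swap_z_exp.
Qed.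

Lemma unit_denom : Q \is a GRing.unit.
Proof.
rewrite !fps_unitE -fps_swapE fps_swap_denom fps_dilateE mulr1.
by have := cluster_denom_unit s m; rewrite fps_unitE.
Qed.

Lemma fps_swap_denomV : fps_swap Q^-1 = S q^-1.
Proof.
have UQ : fps_swap Q \is a GRing.unit.
  have := unit_denom; rewrite !fps_unitE; exact: id.
apply: (mulIr UQ); rewrite -(rmorphM (@fps_swap R)) mulVr ?unit_denom // rmorph1.
by rewrite fps_swap_denom -(rmorphM S) mulVr ?cluster_denom_unit // rmorph1.
Qed.

(** Kept over an arbitrary ring so that [s] can be the variable ['X] as well as 0. *)
Definition hadamard_arg : T :=
  z_ser R / (1 - var_t R)
  + 4%:R * var_t R * (sT - 1) * z_ser R ^+ m
    / ((1 - var_t R ^+ 2) * (1 + var_t R) * Q).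

Lemma fps_swap_hadamard_arg :
  fps_swap hadamard_arg
  = fpsC g * S fpsX + fpsC (u * g) * S (cluster_series s m).
Proof.
have -> : hadamard_arg = (1 - var_t R)^-1 * z_ser R
    + u_ser R * (1 - var_t R)^-1 * ((sT - 1) * z_ser R ^+ m * Q^-1).
  rewrite /hadamard_arg /u_ser mulrC; congr (_ + _).
  (* This factorization turns 4t / ((1 - t^2)(1 + t)) into u / (1 - t). *)
  have -> : (1 - var_t R ^+ 2) * (1 + var_t R) = (1 + var_t R) ^+ 2 * (1 - var_t R).
    by ring.
  have UD := unit_1Dvar_t; have UB := unit_1Bvar_t; have UQ := unit_denom.
  by rewrite !invrM ?unitrM ?UQ ?UB ?unitrX ?UD //; ring.
rewrite (rmorphD (@fps_swap R)); congr (_ + _).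
  by rewrite (rmorphM (@fps_swap R)) /= fps_swap_1BtV fps_swap_z.
rewrite (rmorphM (@fps_swap R)) /= [fps_swap (u_ser R * _)](rmorphM (@fps_swap R)) /=.
rewrite fps_swap_1BtV fps_swap_u -(rmorphM (@fpsC K)); congr (_ * _).
rewrite (rmorphM (@fps_swap R)) /= [fps_swap (_ * _ ^+ _)](rmorphM (@fps_swap R)) /=.
rewrite fps_swap_denomV fps_swap_sB1 fps_swap_z_exp.
by rewrite /cluster_series (rmorphM S) (rmorphM S).
Qed.

Lemma coef_chain_series D n k :
  (\sum_(c < (2 * k).+1) chains D n c)%N%:R
  = (r ^+ n.+1 * u ^+ num_runs D n * g) k.
Proof. by rewrite -chain_seriesE. Qed.

(** The cluster series starts in degree m >= 2. Hence x^1 comes from z / (1 - t) alone, without u,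
    and all higher degrees come from the cluster term, with one u for the single run of descents.
    For n = 0 both sides vanish, whatever [n.-1] gives. *)
Lemma coef_hadamard_arg k n :
  hadamard_arg k n = (fpsX + cluster_series s m) n
     * (\sum_(c < (2 * k).+1) chains (fun=> true) n.-1 c)%N%:R.
Proof.
have -> : hadamard_arg k n = fpsX n * (g * r ^+ n) k
    + cluster_series s m n * (u * g * r ^+ n) k.
  by rewrite -fps_swapE fps_swap_hadamard_arg !coef_fpsD !coef_fpsCM_dilate.
case: n => [|[|n]].
- by rewrite coef_fpsD coef_cluster_series_small ?(ltnW m_gt1) // !mul0r !addr0 !mul0r.
- rewrite coef_fpsD coef_cluster_series_small // mul0r !addr0 coef_chain_series.
  by rewrite /num_runs big_ord0; congr (_ * fps_coef _ k); ring.
- rewrite coef_fpsD coef_chain_series (_ : fpsX n.+2 = 0) // mul0r !add0r.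
  by rewrite /num_runs big_ord_recl big1 //; congr (_ * fps_coef _ k); rewrite /=; ring.
Qed.

Lemma hadamard_arg_x0 k : hadamard_arg k 0%N = 0.
Proof.
rewrite coef_hadamard_arg coef_fpsD coef_cluster_series_small ?(ltnW m_gt1) //.
by rewrite addr0 mul0r.
Qed.

Definition count_series k : {fps R} :=
  Fps (fun n => sum_words n (fun w : seq 'I_(2 * k).+1 =>
    s ^+ sorted_windows word_desc m (map val w))).

Lemma count_seriesE k : count_series k = (1 - hadamard_arg k)^-1.
Proof.
have U : 1 - hadamard_arg k \is a GRing.unit.
  by apply: fps_unit1; rewrite coef_fpsD coef_fpsN hadamard_arg_x0 subr0.
apply: (mulrI U); rewrite divrr // mulrBl mul1r.
have a0 : (fpsX + cluster_series s m) 0%N = 0.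
  by rewrite coef_fpsD coef_cluster_series_small ?(ltnW m_gt1) // addr0.
rewrite {1}/count_series.
rewrite (run_theorem (val : 'I_(2 * k).+1 -> nat) word_desc (ltnW m_gt1)
  (run_weight_cluster s (ltnW m_gt1)) a0).
rewrite -/(count_series k).
suff -> : hadamard_arg k = Fps (fun l => (fpsX + cluster_series s m) l *
    sum_words l (fun w : seq 'I_(2 * k).+1 => (sorted word_desc (map val w))%:R)).
  by rewrite addrK.
apply/fpsP => n; rewrite coef_hadamard_arg; case: n => [|n].
  by rewrite -[RHS]/((fpsX + cluster_series s m) 0%N * _) a0 !mul0r.
by rewrite -sum_words_sorted.
Qed.

(** The number of chains attached to [pi] depends only on the number of descent runs of its inverse,
    which is [ilpk pi]. *)
Lemma coef_Pilpk k n :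
  ((1 - t)^-1 * (Pilpk (decr_perm m) n (fpsC s) u * r ^+ n)) k = count_series k n.
Proof.
case: n => [|n]; first by rewrite /Pilpk eqxx mul1r expr0 mulr1 coef_fps_geo.
rewrite [RHS]sum_words_standardization ?(ltnW m_gt1) // /Pilpk [n.+1 == _]/=.
rewrite mulr_suml mulr_sumr coef_fps_sum; apply: eq_bigr => pi _.
rewrite coef_chain_series -coef_fpsCM (rmorphXn (@fpsC R)) /ilpk lpk_num_runs.
by congr fps_coef; ring.
Qed.

(** On both sides the coefficient of t^k is [count_series k], by standardization on the left and by
    the run theorem on the right. *)
Lemma Pilpk_identity :
  (1 - var_t R)^-1
    * fps_sum2 0 (fun n => Pilpk (decr_perm m) n sT (u_ser R) * z_ser R ^+ n)
  = fps_sum2 0 (fun n => hadamard_pow hadamard_arg n).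
Proof.
have swapP n : fps_swap (Pilpk (decr_perm m) n sT (u_ser R))
    = fpsC (Pilpk (decr_perm m) n (fpsC s) u).
  rewrite /Pilpk; case: eqP => _; first by rewrite !rmorph1.
  rewrite (rmorph_sum (@fps_swap R)) (rmorph_sum (@fpsC K)) /=; apply: eq_bigr => pi _.
  rewrite (rmorphM (@fps_swap R)) /= !(rmorphXn (@fps_swap R)) /= fps_swapCC fps_swap_u.
  by rewrite -!(rmorphXn (@fpsC K)) -(rmorphM (@fpsC K)).
apply/fpsP => k; rewrite fps_sum2_hadamard_pow ?hadamard_arg_x0 // -count_seriesE.
apply/fpsP => n; rewrite -coef_Pilpk -[LHS]fps_swapE.
have swapL F : fps_swap ((1 - var_t R)^-1 * F) = fpsC g * fps_swap F.
  by rewrite (rmorphM (@fps_swap R)) /= fps_swap_1BtV.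
rewrite swapL coef_fpsCM; congr (fps_coef (_ * _) k); apply/fpsP => j.
by rewrite fps_swapE (coef_sum_z_ser _ _ swapP).
Qed.

End MainIdentity.

(** * Avoidance and explicit coefficients *)

(** At s = 0 the denominator, with s - 1 kept as [0 - 1], is the geometric sum 1 + z + ... +
    z^(m-1). *)
Lemma sum_expr_from1 (R : comNzRingType) (z : R) m : (0 < m)%N ->
  (1 - z) * (1 - (0 - 1) * \sum_(1 <= l < m) z ^+ l) = 1 - z ^+ m.
Proof.
move=> m_gt0; rewrite -opprB -[RHS]opprB subrX1 mulNr; congr (- (_ * _)).
rewrite -(big_mkord xpredT (fun l => z ^+ l)) [RHS]big_ltn // expr0; ring.
Qed.

Section Avoiding.
Variables (R : comUnitRingType) (m : nat).
Hypothesis m_gt1 : (2 <= m)%N.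

Let m_gt0 : (0 < m)%N := ltnW m_gt1.
Local Notation t := (var_t R).
Local Notation z := (z_ser R).
Local Notation arg := (hadamard_arg (0 : R) m).

Lemma unit_1Bz : 1 - z \is a GRing.unit.
Proof.
rewrite !fps_unitE !coef_fpsD !coef_fpsN -(fps_swapE z) fps_swap_z.
by rewrite fps_dilateE rmorph0 mul0r subr0 unitr1.
Qed.

Lemma hadamard_arg0 :
  arg = ((1 + t) ^+ 2 * z - 4%:R * t * z ^+ m - (1 - t) ^+ 2 * z ^+ m.+1)
        / ((1 - t ^+ 2) * (1 + t) * (1 - z ^+ m)).
Proof.
rewrite /hadamard_arg !rmorph0 -(sum_expr_from1 z m_gt0).
have UD := unit_1Dvar_t R; have UB := unit_1Bvar_t R; have UZ := unit_1Bz.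
have := unit_denom (0 : R) m; rewrite !rmorph0; move: (sum_expr_from1 z m_gt0).
set Q := 1 - _ * \sum_(_ <= _ < _) _ => ZQ UQ.
have -> : 1 - t ^+ 2 = (1 - t) * (1 + t) by ring.
have UU : (1 - t) * (1 + t) * (1 + t) * ((1 - z) * Q) \is a GRing.unit.
  by rewrite !unitrM UD UB UZ UQ.
apply: (mulIr UU); rewrite divrK // mulrDl.
have -> : (1 - t) * (1 + t) * (1 + t) * ((1 - z) * Q)
   = (1 - t) * (1 + t) * (1 + t) * Q * (1 - z) by ring.
rewrite [X in _ + X = _]mulrA divrK ?unitrM ?UD ?UB ?UQ //.
have -> : z / (1 - t) * ((1 - t) * (1 + t) * (1 + t) * Q * (1 - z))
  = z / (1 - t) * (1 - t) * (1 + t) ^+ 2 * ((1 - z) * Q) by ring.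
by rewrite divrK // ZQ [z ^+ m.+1]exprS; ring.
Qed.

Lemma coef_hadamard_sum k :
  fps_sum2 0 (fun n => hadamard_pow arg n) k = (1 - arg k)^-1.
Proof.
by rewrite fps_sum2_hadamard_pow // hadamard_arg_x0.
Qed.

Lemma sum_mult_eq n b : (n < b)%N ->
  \sum_(1 <= j < b) ((n == j * m)%N%:R : R) = ((0 < n) && (m %| n))%N%:R.
Proof.
move=> lt_nb; have [/andP[n_gt0 /dvdnP[q n_qm]] | not_mult] := boolP (_ && _).
  have q_in : q \in index_iota 1 b.
    rewrite mem_index_iota; move: n_gt0 lt_nb; rewrite n_qm muln_gt0 => /andP[-> _].
    by apply: leq_ltn_trans; rewrite leq_pmulr.
  rewrite (bigD1_seq q) ?iota_uniq //= n_qm eqxx big1 ?addr0 // => j ne_jq.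
  by rewrite eqn_pmul2r // eq_sym (negPf ne_jq).
rewrite big_nat big1 // => j /andP[j_gt0 _]; case: eqP => // n_jm.
by rewrite n_jm dvdn_mull // muln_gt0 j_gt0 m_gt0 in not_mult.
Qed.

(** At s = 0 the series is -y^m (1 - y) / (1 - y^m) = (y - 1) H, where H is the sum of y^(jm) over j
    >= 1; indices j > n cannot contribute to degree n. *)
Lemma cluster_series0 n b : (n < b)%N ->
  cluster_series (0 : R) m n
  = \sum_(1 <= j < b) ((n == j * m + 1)%N%:R - (n == j * m)%N%:R).
Proof.
move=> lt_nb; pose H : {fps R} := Fps (fun i => ((0 < i) && (m %| i))%N%:R).
have HX : H * (1 - fpsX ^+ m) = fpsX ^+ m.
  apply/fpsP => i; rewrite mulrBr mulr1 mulrC.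
  rewrite coef_fpsD coef_fpsN coef_fpsXnM coef_fpsXn.
  rewrite [H i]/=; case: (ltngtP i m) => [lt_im | lt_mi | ->].
  - case: i lt_im => [|i] lt_im; first by rewrite subr0.
    by rewrite gtnNdvd // subr0.
  - rewrite [H _]/= subn_gt0 lt_mi (leq_trans _ lt_mi) //.
    by rewrite dvdn_subl ?(ltnW lt_mi) // subrr.
  - by rewrite [H _]/= subnn m_gt0 dvdnn subr0.
have -> : cluster_series (0 : R) m = fpsX * H - H.
  have := cluster_denom_unit (0 : R) m; have := sum_expr_from1 (fpsX : {fps R}) m_gt0.
  rewrite /cluster_series rmorph0; set q := 1 - _ * \sum_(_ <= _ < _) _ => Xq Uq.
  apply: (mulIr Uq); rewrite divrK // -[in LHS]HX -Xq; ring.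
rewrite sumrB coef_fpsD coef_fpsN sum_mult_eq // coef_fpsXM; congr (_ - _).
case: n lt_nb => [|n] lt_nb.
  by rewrite big1 // => j _; rewrite addn1.
under eq_bigr do rewrite addn1 eqSS.
by rewrite sum_mult_eq // ltnW.
Qed.

End Avoiding.

(** * Binomial formula for the number of descending words *)

Section BinomialSeries.
Variable R : comUnitRingType.
Local Notation t := (fpsX : {fps R}).

Lemma coef_1DX_exp n i : ((1 + t) ^+ n) i = 'C(n, i)%:R.
Proof.
elim: n i => [|n IHn] i; first by rewrite coef_fps1 bin0n.
rewrite exprS mulrDl mul1r coef_fpsD coef_fpsXM IHn.
case: i => [|i]; first by rewrite !bin0 addr0.
by rewrite IHn binS natrD.
Qed.

Lemma coef_1BX_inv_exp n i : ((1 - t)^-1 ^+ n.+1) i = 'C(i + n, i)%:R.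
Proof.
elim: n i => [|n IHn] i; first by rewrite addn0 binn expr1 coef_fps_geo.
have recE j : ((1 - t)^-1 ^+ n.+2) j.+1
    = ((1 - t)^-1 ^+ n.+2) j + ((1 - t)^-1 ^+ n.+1) j.+1.
  have -> : (1 - t)^-1 ^+ n.+1 = (1 - t) * (1 - t)^-1 ^+ n.+2.
    by rewrite [_ ^+ n.+2]exprS mulrA divrr ?mul1r // unit_1Bt.
  by rewrite mulrBl mul1r coef_fpsD coef_fpsN coef_fpsXM addrCA subrr addr0.
elim: i => [|i IHi]; first by rewrite coef_fps0X coef_fps_geo expr1n bin0.
by rewrite recE IHi IHn -natrD [in RHS]addSn binS addSnnS addnC.
Qed.

(** With a single run, r^(n+2) u / (1 - t) equals 4t (1 + t)^n / (1 - t)^(n+3). The sum is the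
    convolution of the two binomial series, shifted by the factor t. *)
Lemma chains_true_binomial n k :
  (\sum_(c < (2 * k.+1).+1) chains (fun=> true) n.+1 c)%N%:R
  = (4 * \sum_(1 <= l < k.+2) 'C(l + n.+2 - 1, l - 1) * 'C(n, k.+1 - l))%N%:R :> R.
Proof.
have runs1 : num_runs (fun=> true) n.+1 = 1%N by rewrite /num_runs big_ord_recl big1.
have serE : ((1 + t) / (1 - t)) ^+ n.+2 * (4%:R * t / (1 + t) ^+ 2) ^+ 1 / (1 - t)
    = fpsC 4%:R * (t * ((1 - t)^-1 ^+ n.+3 * (1 + t) ^+ n)).
  have U : (1 + t) ^+ 2 \is a GRing.unit by rewrite unitrX // unit_1Dt.
  rewrite rmorph_nat expr1 exprMn.
  transitivity (4%:R * (t * ((1 - t)^-1 ^+ n.+3 * (1 + t) ^+ n))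
     * ((1 + t) ^+ 2 / (1 + t) ^+ 2)); last by rewrite divrr // mulr1.
  have -> : (1 + t) ^+ n.+2 = (1 + t) ^+ n * (1 + t) ^+ 2 by rewrite -exprD addn2.
  by rewrite [_ ^+ n.+3]exprSr; ring.
rewrite coef_chain_series runs1 serE.
rewrite coef_fpsCM coef_fpsXM coef_fpsM natrM natr_sum big_add1 big_mkord.
congr (_ * _); apply: eq_bigr => i _.
rewrite coef_1BX_inv_exp coef_1DX_exp -natrM addSn.
by rewrite !subSS !subn0.
Qed.

Lemma chains_true_first (d : nat -> bool) n : (\sum_(c < n) chains d 0 c = n)%N.
Proof. by rewrite sum1_card card_ord. Qed.

End BinomialSeries.

Lemma fps_sum2_monomials (R : comUnitRingType) (c : nat -> {fps R}) k :
  fps_sum2 1 (fun j => fpsC (c j) * var_t R ^+ j) k = if k is 0 then 0 else c k.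
Proof.
have termE j : (fpsC (c j) * var_t R ^+ j) k = c j * (k == j)%:R.
  by rewrite coef_fpsCM coef_fpsXn.
apply/fpsP => i.
transitivity (\sum_(1 <= j < k.+1) (c j * (k == j)%:R) i).
  rewrite [LHS](@fps_sumE _ 1 k.+1) => [|j lt_kj].
    by apply: eq_bigr => j _; rewrite termE.
  by rewrite termE ltn_eqF // mulr0.
case: k termE => [|k] _; first by rewrite big_geq.
rewrite big_nat_recr // eqxx mulr1 big_nat big1 => [|j /andP[_ lt_jk]].
  exact: add0r.
by rewrite gtn_eqF // mulr0.
Qed.

Section Explicit.
Variables (R : comUnitRingType) (m : nat).
Hypothesis m_gt1 : (2 <= m)%N.

Let m_gt0 : (0 < m)%N := ltnW m_gt1.
Local Notation x := (fpsX : {fps R}).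
Local Notation arg := (hadamard_arg (0 : R) m).

(** For k = 0 the only letter is 0, which is even and cannot repeat in a descending word. *)
Lemma hadamard_arg_coef0 : arg 0%N = x.
Proof.
apply/fpsP => n; rewrite coef_hadamard_arg // coef_fpsD muln0 big_ord1.
case: n => [|[|n]].
- by rewrite coef_cluster_series_small // addr0 mul0r.
- by rewrite coef_cluster_series_small // addr0 mulr1.
- by rewrite /= big_ord0 mul0n mulr0.
Qed.

(** The 2k + 3 words of one letter give the linear term; [cluster_series0] leaves only the lengths
    jm and jm + 1, whose descending words are counted by [e_coef] and [e'_coef]. *)
Lemma hadamard_arg_coefS k :
  arg k.+1 = (2 * k.+1 + 1)%:R * x
    - fps_sum 1 (fun j => (e_coef m j k.+1)%:R * x ^+ (j * m)
                          - (e'_coef m j k.+1)%:R * x ^+ (j * m + 1)).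
Proof.
apply/fpsP => n; rewrite coef_hadamard_arg // !coef_fpsD coef_fpsN.
have natE a (f : {fps R}) : (a%:R * f) n = a%:R * f n.
  by rewrite -(rmorph_nat (@fpsC R)) coef_fpsCM.
have termE j : ((e_coef m j k.+1)%:R * x ^+ (j * m)
      - (e'_coef m j k.+1)%:R * x ^+ (j * m + 1)) n
    = (e_coef m j k.+1)%:R * (n == j * m)%N%:R
      - (e'_coef m j k.+1)%:R * (n == j * m + 1)%N%:R.
  by rewrite coef_fpsD coef_fpsN !natE !coef_fpsXn.
rewrite (cluster_series0 R m_gt1 (ltnSn n)).
rewrite (@fps_sumE _ 1 n.+1) => [|j lt_nj]; last first.
  have lt_njm : (n < j * m)%N by apply: leq_trans lt_nj _; rewrite leq_pmulr.
  by rewrite termE !ltn_eqF ?mulr0 ?subr0 // addn1 ltnW.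
rewrite natE mulrDl; congr (_ + _).
  case: n {termE natE} => [|[|n]]; rewrite ?mul0r ?mulr0 //.
  by rewrite chains_true_first mul1r mulr1 addn1.
rewrite mulr_suml -sumrN !big_nat; apply: eq_bigr => j /andP[j_gt0 _].
rewrite termE opprB mulrBl; congr (_ - _); case: eqP; rewrite ?mul0r ?mulr0 //.
- move=> n_jm; have : (2 <= j * m)%N by rewrite (leq_trans m_gt1) // leq_pmull.
  rewrite mul1r mulr1 n_jm addn1; case jm: (j * m)%N => [|[|p]] // _.
  rewrite chains_true_binomial /e'_coef jm; congr (_%:R); congr (_ * _)%N.
  apply: eq_big_nat => l /andP[l_gt0 _].
  by rewrite !subn1 !addnS /=.
- move=> n_jm; have : (2 <= j * m)%N by rewrite (leq_trans m_gt1) // leq_pmull.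
  rewrite mul1r mulr1 n_jm; case jm: (j * m)%N => [|[|p]] // _.
  by rewrite chains_true_binomial /e_coef jm subn2.
Qed.

End Explicit.

Theorem theorem4p8 (m : nat) (hm : (2 <= m)%N) :
  [/\
    (let t := var_t {poly rat} in
     let s := var_s in
     let u := u_ser {poly rat} in
     let z := z_ser {poly rat} in
     (1 - t)^-1 * fps_sum2 0 (fun n => Pilpk (decr_perm m) n s u * z ^+ n)
     = fps_sum2 0 (fun n => hadamard_pow
         (z / (1 - t)
          + 4%:R * t * (s - 1) * z ^+ m
            / ((1 - t ^+ 2) * (1 + t)
               * (1 - (s - 1) * \sum_(1 <= l < m) z ^+ l))) n)),
    (let t := var_t rat in
     let u := u_ser rat in
     let z := z_ser rat in
     (1 - t)^-1 * fps_sum2 0 (fun n => Pilpk0 (decr_perm m) n u * z ^+ n)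
     = fps_sum2 0 (fun n => hadamard_pow
         (((1 + t) ^+ 2 * z - 4%:R * t * z ^+ m - (1 - t) ^+ 2 * z ^+ m.+1)
          / ((1 - t ^+ 2) * (1 + t) * (1 - z ^+ m))) n))
  & (let t := var_t rat in
     let u := u_ser rat in
     let z := z_ser rat in
     let x : {fps rat} := fpsX in
     (1 - t)^-1 * fps_sum2 0 (fun n => Pilpk0 (decr_perm m) n u * z ^+ n)
     = fpsC (1 - x)^-1
       + fps_sum2 1 (fun k =>
           fpsC (1 - (2 * k + 1)%:R * x
                 + fps_sum 1 (fun j => (e_coef m j k)%:R * x ^+ (j * m)
                              - (e'_coef m j k)%:R * x ^+ (j * m + 1)))^-1
           * t ^+ k))].
Proof.
(* Both (b) and (c) start from the general identity at s = 0. *)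
have avoidE : (1 - var_t rat)^-1
      * fps_sum2 0 (fun n => Pilpk0 (decr_perm m) n (u_ser rat) * z_ser rat ^+ n)
    = fps_sum2 0 (fun n => hadamard_pow (hadamard_arg (0 : rat) m) n).
  rewrite -(Pilpk_identity (0 : rat) hm) /Pilpk0.
  by rewrite !(rmorph0 (@fpsC _)).
split; first exact: (Pilpk_identity ('X : {poly rat}) hm).
  by cbv zeta; rewrite avoidE hadamard_arg0.
cbv zeta; rewrite avoidE; apply/fpsP => k; rewrite coef_hadamard_sum //.
rewrite [RHS]coef_fpsD fps_sum2_monomials; case: k => [|k].
  by rewrite addr0 hadamard_arg_coef0.
by rewrite [X in X + _]/= add0r hadamard_arg_coefS // opprB addrA addrAC.
Qed.
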